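(* If $g\in GL(2,\mathcal{O}_{-3})$ is of finite order $r$ and $\det(g)=e^{\frac{2\pi i}{3}}$, then $$\mathrm{tr}(g)\in\left\{0,\pm\tfrac{1+\sqrt{-3}}{2},\pm(1+\sqrt{-3})\right\},\qquad r\in\{3,6,12\}.$$ More precisely, for the eigenvalues $\lambda_1,\lambda_2$ of $g$ (up to a transposition): (i) $\mathrm{tr}(g)=0$ or, equivalently, $\lambda_1=e^{\frac{5\pi i}{6}}$, $\lambda_2=e^{-\frac{\pi i}{6}}$, if and only if $g$ is of order $12$; (ii) if $\mathrm{tr}(g)=\frac{1+\sqrt3i}{2}$ or, equivalently, $\lambda_1=e^{\frac{2\pi i}{3}}$, $\lambda_2=1$, then $g$ is of order $3$; (iii) if $\mathrm{tr}(g)=-1-\sqrt3i$ or, equivalently, $g=e^{-\frac{2\pi i}{3}}I_2$, then $g$ is of order $3$; (iv) if $\mathrm{tr}(g)=\frac{-1-\sqrt3i}{2}$ or, equivalently, $\lambda_1=e^{-\frac{\pi i}{3}}$, $\lambda_2=-1$, then $g$ is of order $6$; (v) if $\mathrm{tr}(g)=1+\sqrt3i$ or, equivalently, $g=e^{\frac{\pi i}{3}}I_2$, then $g$ is of order $6$.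
   Context: $\mathcal{O}_{-3}=\mathbb{Z}+\frac{1+\sqrt{-3}}{2}\mathbb{Z}$ is the ring of the Eisenstein integers, $\sqrt{-3}=i\sqrt3$, and $GL(2,\mathcal{O}_{-3})$ is the group of $2\times2$ matrices over $\mathcal{O}_{-3}$ with determinant in $\mathcal{O}_{-3}^*=\langle e^{\frac{\pi i}{3}}\rangle$. *)

(* Defs.v *)
From mathcomp Require Import all_boot all_order all_algebra.
From mathcomp Require Import reals trigo.
From mathcomp Require Import complex.

Set Implicit Arguments.
Unset Strict Implicit.
Unset Printing Implicit Defensive.

Import GRing.Theory Num.Theory.
Local Open Scope ring_scope.
Local Open Scope complex_scope.

(* For R a realType, R[i] is the field of complex numbers. *)

Definition expi (R : realType) (t : R) : R[i] := cos t +i* sin t.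

Definition sqrtm3 (R : realType) : R[i] := 0 +i* Num.sqrt 3.

Definition eisenstein (R : realType) (z : R[i]) : Prop :=
  exists a b : int, z = a%:~R + (1 + sqrtm3 R) / 2 * b%:~R.

Definition eisenstein_unit (R : realType) (z : R[i]) : Prop :=
  eisenstein z /\ exists2 w : R[i], eisenstein w & z * w = 1.

Definition GL2_eisenstein (R : realType) (g : 'M[R[i]]_2) : Prop :=
  (forall i j, eisenstein (g i j)) /\ eisenstein_unit (\det g).

(* The order of g in GL(2) over the Eisenstein integers, an infinite group, hence outside
   the scope of the order #[g] of the finite group library. *)
Definition has_order (R : realType) (g : 'M[R[i]]_2) (r : nat) : Prop :=
  [/\ (0 < r)%N, g ^+ r = 1 & forall k : nat, (0 < k < r)%N -> g ^+ k <> 1].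

(* The eigenvalues of g, counted with algebraic multiplicity, are l1 and l2;
   this is symmetric in l1 and l2, i.e. insensitive to their transposition. *)
Definition has_eigenvalues (R : realType) (g : 'M[R[i]]_2) (l1 l2 : R[i]) :
    Prop :=
  char_poly g = ('X - l1%:P) * ('X - l2%:P).

(* Main.v *)
Require Import Defs.
From mathcomp Require Import all_boot all_order all_algebra.
From mathcomp Require Import reals trigo.
From mathcomp Require Import complex.
From mathcomp Require Import ring lra.

Set Implicit Arguments.
Unset Strict Implicit.
Unset Printing Implicit Defensive.

Import Order.TTheory GRing.Theory Num.Theory.
Local Open Scope ring_scope.

(** Let w be the sixth root of unity (1 + sqrt(-3)) / 2, so that w^2 = w - 1 and
    det g = w^2.  The idea is to pass to h = w^-1 g, which has determinant 1 and
    is still of finite order.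

    An eigenvalue l of h is a root of unity and the other one is l^-1, the
    complex conjugate of l; hence tr h = l + l^-1 is real of absolute value at
    most 2 (torsion_trace).  Writing tr g = a + b w with integers a, b gives
    tr h = a w^-1 + b, which is real only if a = 0.  So tr h = b is one of
    0, 1, -1, 2, -2, and tr g = b w (eisenstein_trace).

    Cayley-Hamilton, h^2 = b h - 1, then determines h well enough: h^2 = -1 for
    b = 0, h^3 = -1 for b = 1, h^3 = 1 for b = -1.  For b = 2 it says that h is
    unipotent, and a unipotent matrix of finite order in characteristic 0 is
    the identity (unipotent_torsion); b = -2 follows by changing the sign of h.
    Since w^3 = -1, this yields g^3 = 1, g^3 = -1 or g^6 = -1.

    The order of det g is 3 and divides r (dvdn3_order), which leaves a single
    possible r in each case: r = 3, 6, 12 respectively.  The conditions on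
    eigenvalues are conditions on the trace, because the determinant being
    given, the trace determines the characteristic polynomial
    (has_eigenvaluesE). *)

(** * Two-by-two matrices *)

Lemma char_poly_mx22 (A : comNzRingType) (g : 'M[A]_2) :
  char_poly g = 'X^2 - (\tr g) *: 'X + (\det g)%:P.
Proof.
have g1 := char_poly_trace g isT.
have g0 := char_poly_det g.
have g2 : (char_poly g)`_2 = 1.
  by have /monicP := char_poly_monic g; rewrite lead_coefE size_char_poly.
apply/polyP => i; rewrite coefD coefB coefXn coefZ coefX coefC.
case: i => [|[|[|i]]] /=.
- by rewrite g0 sqrrN expr1n mul1r mulr0 subr0 add0r.
- by rewrite g1 mulr1 add0r addr0.
- by rewrite g2 mulr0 subr0 addr0.
- by rewrite nth_default ?size_char_poly// mulr0 subr0 addr0.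
Qed.

Lemma Cayley_Hamilton_mx22 (A : comNzRingType) (g : 'M[A]_2) :
  g ^+ 2 = \tr g *: g - (\det g)%:M.
Proof.
have /eqP := Cayley_Hamilton g; rewrite char_poly_mx22 !(rmorphD, rmorphN) /=.
rewrite horner_mx_C linearZ /= rmorphXn /= horner_mx_X.
by rewrite -addrA addr_eq0 opprD opprK => /eqP.
Qed.

Lemma has_eigenvaluesE (R : realType) (g : 'M[R[i]]_2) (l1 l2 : R[i]) :
  \det g = l1 * l2 -> has_eigenvalues g l1 l2 <-> \tr g = l1 + l2.
Proof.
move=> dg; rewrite /has_eigenvalues char_poly_mx22 dg.
have -> : ('X - l1%:P) * ('X - l2%:P) =
    'X^2 - (l1 + l2) *: 'X + (l1 * l2)%:P :> {poly R[i]}.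
  by rewrite -mul_polyC polyCD polyCM; ring.
split=> [/(congr1 (fun p : {poly R[i]} => p`_1))|-> //].
rewrite !(coefB, coefD, coefXn, coefZ, coefX, coefC) /=.
by rewrite !mulr1 !addr0 !add0r => /oppr_inj.
Qed.

Lemma mxtrace2 (A : nzRingType) (g : 'M[A]_2) : \tr g = g 0 0 + g 1 1.
Proof.
rewrite /mxtrace big_ord_recl big_ord1.
by congr (g _ _ + g _ _); apply: val_inj.
Qed.

(** * Matrices of finite order *)

Lemma detX (A : comNzRingType) (m : nat) (g : 'M[A]_m.+1) (k : nat) :
  \det (g ^+ k) = \det g ^+ k.
Proof.
by elim: k => [|k IHk]; rewrite ?det1// !exprS det_mulmx IHk.
Qed.

Lemma has_order_dvd (R : realType) (g : 'M[R[i]]_2) (r k : nat) :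
  has_order g r -> (g ^+ k == 1) = (r %| k)%N.
Proof.
case=> r_gt0 gr gmin.
have -> : g ^+ k = g ^+ (k %% r)%N.
  by rewrite {1}(divn_eq k r) exprD mulnC exprM gr expr1n mul1r.
rewrite /dvdn; have := ltn_pmod k r_gt0; case: (k %% r)%N => [|m] mr.
  by rewrite expr0 !eqxx.
by apply/negP => /eqP /gmin; apply.
Qed.

Lemma expr1Dsqr0 (A : nzRingType) (N : A) (k : nat) :
  N ^+ 2 = 0 -> (1 + N) ^+ k = 1 + N *+ k.
Proof.
move=> N2; elim: k => [|k IHk]; first by rewrite addr0.
by rewrite exprSr IHk mulrDr mulr1 mulrDl mul1r mulrnAl -expr2 N2 mul0rn
   addr0 -addrA -mulrSr.
Qed.

(** If N = h - 1 has square zero, then h^n = 1 + n N, so h^n = 1 forces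
    n N = 0, and n is invertible. *)
Lemma unipotent_torsion (F : numFieldType) (h : 'M[F]_2) (n : nat) :
  (0 < n)%N -> h ^+ n = 1 -> (h - 1) ^+ 2 = 0 -> h = 1.
Proof.
move=> n_gt0 hn /(expr1Dsqr0 n); rewrite addrC subrK hn.
move/eqP; rewrite addrC -subr_eq subrr eq_sym -scaler_nat scaler_eq0.
by rewrite pnatr_eq0 -[n == 0%N]negbK -lt0n n_gt0 subr_eq0 => /eqP.
Qed.

(** * Torsion in SL2 *)

Section SL2.
Variables (C : numClosedFieldType) (h : 'M[C]_2) (n : nat).
Hypotheses (n_gt0 : (0 < n)%N) (hn : h ^+ n = 1) (deth : \det h = 1).

Lemma eigenvalue_torsion (l : C) : eigenvalue h l -> l ^+ n = 1.
Proof.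
case/eigenvalueP=> v vh v_neq0.
have vhk k : v *m h ^+ k = l ^+ k *: v.
  elim: k => [|k IHk]; first by rewrite !expr0 mulmx1 scale1r.
  by rewrite exprSr mulmxA IHk -scalemxAl vh scalerA -exprSr.
have := vhk n; rewrite hn mulmx1 -[X in X = _]scale1r => /eqP.
by rewrite -subr_eq0 -scalerBl scaler_eq0 (negPf v_neq0) orbF subr_eq0
   eq_sym => /eqP.
Qed.

(** If l is an eigenvalue of h, then |l| = 1, so l^-1 is the conjugate of l and
    the characteristic equation l^2 - (tr h) l + 1 = 0 reads
    tr h = l + conj l. *)
Lemma torsion_trace : (\tr h \is Num.real) && (`|\tr h| <= 2).
Proof.
have /closed_rootP[l rl] : size (char_poly h) != 1 by rewrite size_char_poly.
have ln : l ^+ n = 1 by apply: eigenvalue_torsion; rewrite eigenvalue_root_char.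
have l1 : `|l| = 1.
  by apply/eqP; rewrite -(pexpr_eq1 n_gt0)// -normrX ln normr1.
have l_neq0 : l != 0 by rewrite -normr_eq0 l1 oner_eq0.
have lC : l * l^* = 1 by rewrite -normCK l1 expr1n.
have -> : \tr h = l + l^*.
  apply: (mulfI l_neq0); rewrite mulrDr lC.
  move: rl; rewrite char_poly_mx22 deth /root !hornerE.
  move=> /eqP rl; apply/eqP; rewrite -subr_eq0 -oppr_eq0 -[X in _ == X]rl.
  by apply/eqP; ring.
rewrite CrealE rmorphD /= conjCK addrC eqxx /=.
by rewrite (le_trans (ler_normD _ _))// norm_conjC l1.
Qed.

Lemma SL2_trace0 : \tr h = 0 -> h ^+ 2 = -1.
Proof. by move=> th; rewrite Cayley_Hamilton_mx22 th deth scale0r sub0r. Qed.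

Lemma SL2_trace1 : \tr h = 1 -> h ^+ 3 = -1.
Proof.
move=> th; have h2 : h ^+ 2 = h - 1.
  by rewrite Cayley_Hamilton_mx22 th deth scale1r.
by rewrite exprS h2 mulrBr mulr1 -expr2 h2 addrAC subrr sub0r.
Qed.

Lemma SL2_traceN1 : \tr h = -1 -> h ^+ 3 = 1.
Proof.
move=> th; have h2 : h ^+ 2 = - h - 1.
  by rewrite Cayley_Hamilton_mx22 th deth scaleN1r.
by rewrite exprS h2 mulrBr mulr1 mulrN -expr2 h2 opprD !opprK addrAC subrr add0r.
Qed.

Lemma SL2_trace2 : \tr h = 2 -> h = 1.
Proof.
move=> th; apply: (unipotent_torsion n_gt0 hn).
rewrite sqrrB1 Cayley_Hamilton_mx22 th deth scaler_nat.
by rewrite [X in X - _]addrC addrK addNr.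
Qed.

End SL2.

Lemma SL2_traceN2 (C : numClosedFieldType) (h : 'M[C]_2) (n : nat) :
  (0 < n)%N -> h ^+ n = 1 -> \det h = 1 -> \tr h = -2 -> h = -1.
Proof.
move=> n_gt0 hn deth th; apply: oppr_inj; rewrite opprK.
apply: (@SL2_trace2 _ _ (n * 2)%N).
- by rewrite muln_gt0 n_gt0.
- by rewrite mulnC exprM sqrrN -exprM mulnC exprM hn expr1n.
- by rewrite -scaleN1r detZ deth sqrrN expr1n mulr1.
- by rewrite linearN /= th opprK.
Qed.

(** * Sixth roots of unity *)

Section Eisenstein.
Variable R : realType.

Definition zeta6 : R[i] := (1 + sqrtm3 R) / 2.
Local Notation w := zeta6.

Lemma zeta6_sqr : w ^+ 2 = w - 1.
Proof.
have s3 : sqrtm3 R ^+ 2 = - 3.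
  have -> : sqrtm3 R = 'i%C * (Num.sqrt 3)%:C%C by rewrite /sqrtm3; simpc.
  by rewrite exprMn sqr_i -rmorphXn sqr_sqrtr// rmorph_nat mulN1r.
by rewrite /zeta6; field: s3.
Qed.

Lemma zeta6_neq0 : w != 0.
Proof.
apply/eqP => w0; have /eqP := zeta6_sqr.
by rewrite w0 expr0n sub0r eq_sym oppr_eq0 oner_eq0.
Qed.

Lemma conj_zeta6 : w^* = 1 - w.
Proof.
have sC : (sqrtm3 R)^* = - sqrtm3 R.
  by apply/eqP; rewrite eq_complex /= oppr0 !eqxx.
by rewrite /zeta6 rmorphM fmorphV rmorphD /= rmorph1 rmorph_nat sC;
  field.
Qed.

Lemma zeta6_cube : w ^+ 3 = -1.
Proof. by ring: zeta6_sqr. Qed.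

Lemma expiD (x y : R) : expi (x + y) = expi x * expi y.
Proof.
rewrite /expi cosD sinD; apply/eqP; rewrite eq_complex /=.
by rewrite eqxx addrC eqxx.
Qed.

Lemma expi_pi : expi (pi : R) = -1.
Proof.
by apply/eqP; rewrite eq_complex /= cospi sinpi oppr0 !eqxx.
Qed.

(** The cosine c of pi/3 satisfies cos (3 pi/3) = 4 c^3 - 3 c = -1, that is
    (c + 1) (2 c - 1)^2 = 0, and c > 0.  The triple angle formula is read off
    from the real part of (expi (pi/3))^3. *)
Lemma expi_pi3 : expi (pi / 3 : R) = w.
Proof.
have p0 := pi_gt0 R.
have u3 : expi (pi / 3 : R) ^+ 3 = -1.
  by rewrite -expi_pi !exprS expr0 mulr1 -!expiD; congr expi; field.
have c0 : 0 < cos (pi / 3 : R) by apply: cos_gt0_pihalf; lra.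
have s0 : 0 < sin (pi / 3 : R) by apply: sin_gt0_pi; lra.
have cs := cos2Dsin2 (pi / 3 : R).
have c12 : cos (pi / 3 : R) = 1 / 2.
  move: u3; rewrite /expi; move: (cos _) (sin _) c0 s0 cs => c s c0 s0 cs.
  move=> /eqP; rewrite !exprS expr0 mulr1 eq_complex /= => /andP[/eqP u3 _].
  have /eqP : (c + 1) * (2 * c - 1) ^+ 2 = 0.
    have s2 : s ^+ 2 = 1 - c ^+ 2 by rewrite -cs addrAC subrr add0r.
    have u4 : forall z : R, z = -1 -> z + 1 = 0 by move=> z ->; rewrite addNr.
    by rewrite -(u4 _ u3); ring: s2.
  rewrite mulf_eq0 sqrf_eq0 => /orP[] /eqP; lra.
have s12 : sin (pi / 3 : R) = Num.sqrt 3 / 2.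
  apply/eqP; rewrite -(eqrXn2 (n:=2))// ?ltW// ?divr_gt0 ?sqrtr_gt0//.
  by rewrite expr_div_n sqr_sqrtr//; move: cs; rewrite c12 => cs; apply/eqP; lra.
rewrite /expi c12 s12 /zeta6 /sqrtm3; apply/eqP.
rewrite -[2]/(2%:R) -(rmorph_nat (real_complex R)) -fmorphV mulrC.
by rewrite eq_complex /=; apply/andP; split; apply/eqP; field.
Qed.

Lemma expi_2pi3 : expi (2 * pi / 3 : R) = w ^+ 2.
Proof.
have -> : 2 * pi / 3 = pi / 3 + pi / 3 :> R by field.
by rewrite expiD expi_pi3 expr2.
Qed.

Lemma expi_N2pi3 : expi (- (2 * pi / 3) : R) = - w.
Proof.
have /(congr1 (@expi R)) : pi / 3 = - (2 * pi / 3) + pi :> R by field.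
by rewrite expi_pi3 expiD expi_pi mulrN1 => ->; rewrite opprK.
Qed.

Lemma expi_Npi3 : expi (- (pi / 3) : R) = 1 - w.
Proof.
have -> : - (pi / 3) = - (2 * pi / 3) + pi / 3 :> R by field.
by rewrite expiD expi_N2pi3 expi_pi3 mulNr -expr2 zeta6_sqr opprB.
Qed.

Lemma expi_5pi6 : expi (5 * pi / 6 : R) = - expi (- (pi / 6)).
Proof.
have -> : 5 * pi / 6 = - (pi / 6) + pi :> R by field.
by rewrite expiD expi_pi mulrN1.
Qed.

Lemma expi_Npi6_sqr : expi (- (pi / 6) : R) ^+ 2 = 1 - w.
Proof.
by rewrite expr2 -expiD -expi_Npi3; congr expi; field.
Qed.

(** * Finite-order matrices of determinant w^2 *)

Section FiniteOrder.
Variables (g : 'M[R[i]]_2) (r : nat).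
Hypotheses (hr : has_order g r) (dg : \det g = w ^+ 2).

(** det g = w^2 is a primitive cube root of unity, and (det g)^r = 1. *)
Lemma dvdn3_order : (3 %| r)%N.
Proof.
have w2r : (w ^+ 2) ^+ r = 1.
  have [_ /(congr1 determinant) + _] := hr.
  by rewrite detX det1 dg.
have w21 : w ^+ 2 != 1.
  apply/eqP => w2; have := zeta6_cube; rewrite exprSr w2 mul1r => wN1.
  have /eqP := zeta6_sqr; rewrite w2 wN1 -opprD -addr_eq0 -mulr2n -mulrS.
  by rewrite pnatr_eq0.
have w23 : (w ^+ 2) ^+ 3 = 1 by rewrite exprAC zeta6_cube sqrrN expr1n.
move: w2r; rewrite (divn_eq r 3) exprD mulnC exprM w23 expr1n mul1r.
rewrite dvdn_addr ?dvdn_mulr//; have := ltn_pmod r (isT : (0 < 3)%N).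
case: (r %% 3)%N => [|[|[|//]]]// _ /eqP; first by rewrite expr1 (negPf w21).
move=> /eqP w22; move: w23; rewrite exprSr w22 mul1r => /eqP.
by rewrite (negPf w21).
Qed.

Lemma order3 : g ^+ 3 = 1 -> r = 3%N.
Proof.
move/eqP; rewrite (has_order_dvd _ hr) => r3.
by apply/eqP; rewrite eqn_dvd r3 dvdn3_order.
Qed.

Lemma N1_neq1 : (-1 : 'M[R[i]]_2) != 1.
Proof.
by rewrite eq_sym -addr_eq0 -mulr2n -scaler_nat scaler_eq0 pnatr_eq0 oner_eq0.
Qed.

Lemma order6 : g ^+ 3 = -1 -> r = 6%N.
Proof.
move=> g3; have : (r %| 6)%N.
  by rewrite -(has_order_dvd _ hr) (exprM g 3 2) g3 sqrrN expr1n.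
have : ~~ (r %| 3)%N by rewrite -(has_order_dvd _ hr) g3 N1_neq1.
have := dvdn3_order; case/dvdnP => q ->.
rewrite (@dvdn_pmul2r 3 q 1)// (@dvdn_pmul2r 3 q 2)//.
by case: q => [|[|[|q]]]// _ /dvdn_leq -/(_ isT).
Qed.

Lemma order12 : g ^+ 6 = -1 -> r = 12%N.
Proof.
move=> g6; have : (r %| 12)%N.
  by rewrite -(has_order_dvd _ hr) (exprM g 6 2) g6 sqrrN expr1n.
have : ~~ (r %| 6)%N by rewrite -(has_order_dvd _ hr) g6 N1_neq1.
have := dvdn3_order; case/dvdnP => q ->.
rewrite (@dvdn_pmul2r 3 q 2)// (@dvdn_pmul2r 3 q 4)//.
by case: q => [|[|[|[|[|q]]]]]// _ /dvdn_leq -/(_ isT).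
Qed.

(** Scaling by w^-1 brings the determinant to 1; the exponent 6 r kills both the
    scalar w^-1 and g. *)
Let h := w^-1 *: g.
Let n := (6 * r)%N.

Let gE : g = w *: h.
Proof. by rewrite scalerA divff ?scale1r// zeta6_neq0. Qed.

Let n_gt0 : (0 < n)%N.
Proof. by rewrite muln_gt0; case: hr. Qed.

Let hn : h ^+ n = 1.
Proof.
have [_ gr _] := hr.
rewrite exprZn {2}/n mulnC exprM gr expr1n /n exprM exprVn.
by rewrite (exprM w 3 2) zeta6_cube sqrrN !expr1n invr1 expr1n scale1r.
Qed.

Let deth : \det h = 1.
Proof.
by rewrite detZ dg exprVn mulVf// expf_neq0 ?zeta6_neq0.
Qed.

Let trh (b : int) : \tr g = w *~ b -> \tr h = b%:~R.
Proof.
by rewrite linearZ /= => ->; rewrite -mulrzr mulKf// zeta6_neq0.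
Qed.

Let g3E : g ^+ 3 = - h ^+ 3.
Proof. by rewrite gE exprZn zeta6_cube scaleN1r. Qed.

Lemma trace0_order : \tr g = 0 -> r = 12%N.
Proof.
move=> /(@trh 0) th; apply: order12.
rewrite (exprM g 3 2) g3E sqrrN -exprM (exprM h 2 3) (SL2_trace0 deth th).
by rewrite -signr_odd.
Qed.

Lemma trace1_order : \tr g = w -> r = 3%N.
Proof.
by move=> /(@trh 1) th; apply: order3; rewrite g3E (SL2_trace1 deth th) opprK.
Qed.

Lemma traceN1_order : \tr g = - w -> r = 6%N.
Proof.
by move=> /(@trh (-1)) th; apply: order6; rewrite g3E (SL2_traceN1 deth th).
Qed.

Lemma trace2_scalar : \tr g = w *+ 2 -> g = w%:M.
Proof.
move=> /(@trh 2) th; rewrite gE (SL2_trace2 n_gt0 hn deth th).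
exact: scalemx1.
Qed.

Lemma traceN2_scalar : \tr g = - (w *+ 2) -> g = (- w)%:M.
Proof.
move=> /(@trh (-2)) th; rewrite gE (SL2_traceN2 n_gt0 hn deth th).
by rewrite scalerN -scaleNr; exact: scalemx1.
Qed.

(** tr h = a (1 - w) + b is real, and so equal to its conjugate a w + b; hence
    a (2 w - 1) = 0, with 2 w - 1 = sqrt(-3) nonzero. *)
Lemma eisenstein_trace : (forall i j, eisenstein (g i j)) ->
  \tr g \in [:: 0; w; - w; w *+ 2; - (w *+ 2)].
Proof.
move=> gO.
have [a [b tg]] : exists a b : int, \tr g = a%:~R + w * b%:~R.
  have [a0 [b0 g0]] := gO 0 0; have [a1 [b1 g1]] := gO 1 1.
  exists (a0 + a1), (b0 + b1).
  by rewrite mxtrace2 g0 g1 -/w; ring.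
have /andP[/CrealP] := torsion_trace n_gt0 hn deth.
have wV : w^-1 = 1 - w.
  by apply: (mulfI zeta6_neq0); rewrite divff ?zeta6_neq0//; ring: zeta6_sqr.
have -> : \tr h = a%:~R * (1 - w) + b%:~R.
  by rewrite linearZ /= tg wV; ring: zeta6_sqr.
rewrite rmorphD rmorphM !rmorph_int rmorphB /= rmorph1 conj_zeta6 => trhC.
have s_neq0 : 2 * w - 1 != 0.
  have s3 : (2 * w - 1) ^+ 2 = - 3 by ring: zeta6_sqr.
  by apply: contra_eq_neq s3 => ->; rewrite expr0n eq_sym oppr_eq0 pnatr_eq0.
have a0 : a = 0.
  apply/eqP; rewrite -(intr_eq0 R[i]) -[_ == 0]orbF -(negPf s_neq0) -mulf_eq0.
  move/eqP: trhC; rewrite -subr_eq0; congr (is_true (_ == 0)); ring.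
rewrite tg a0 mul0r !add0r -intr_norm (ler_int _ _ 2).
(* The five listed values are the multiples b w with |b| <= 2. *)
move=> b_le2; rewrite mulrzr.
have -> : [:: 0; w; - w; w *+ 2; - (w *+ 2)] =
    [seq w *~ i | i <- [:: 0; 1; -1; 2; -2 : int]] by [].
by apply: map_f; case: b {tg trhC} b_le2 => [[|[|[|b]]]|[|[|b]]].
Qed.

End FiniteOrder.
End Eisenstein.

(** * The classification *)

Theorem proposition21 (R : realType) (g : 'M[R[i]]_2) (r : nat)
    (hg : GL2_eisenstein g) (hr : has_order g r)
    (hdet : \det g = expi (2 * pi / 3)) :
  [/\ \tr g \in [:: 0; (1 + sqrtm3 R) / 2; - ((1 + sqrtm3 R) / 2);
                    1 + sqrtm3 R; - (1 + sqrtm3 R)]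
    & r \in [:: 3; 6; 12]%N] /\
  [/\ (* (i) *)
      (\tr g = 0 <-> has_eigenvalues g (expi (5 * pi / 6)) (expi (- (pi / 6))))
      /\ (\tr g = 0 <-> r = 12%N),
      (* (ii) *)
      (\tr g = (1 + sqrtm3 R) / 2 <-> has_eigenvalues g (expi (2 * pi / 3)) 1)
      /\ (\tr g = (1 + sqrtm3 R) / 2 -> r = 3%N),
      (* (iii) *)
      (\tr g = - 1 - sqrtm3 R <-> g = (expi (- (2 * pi / 3)))%:M)
      /\ (\tr g = - 1 - sqrtm3 R -> r = 3%N),
      (* (iv) *)
      (\tr g = (- 1 - sqrtm3 R) / 2 <->
         has_eigenvalues g (expi (- (pi / 3))) (- 1))
      /\ (\tr g = (- 1 - sqrtm3 R) / 2 -> r = 6%N)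
    & (* (v) *)
      (\tr g = 1 + sqrtm3 R <-> g = (expi (pi / 3))%:M)
      /\ (\tr g = 1 + sqrtm3 R -> r = 6%N)].
Proof.
have [gO _] := hg.
rewrite expi_2pi3 in hdet.
have wE : (1 + sqrtm3 R) / 2 = zeta6 R by [].
have w2E : 1 + sqrtm3 R = zeta6 R *+ 2 by rewrite -wE; field.
have Nw2E : - 1 - sqrtm3 R = - (zeta6 R *+ 2) by rewrite -w2E opprD.
have NwE : (- 1 - sqrtm3 R) / 2 = - zeta6 R by rewrite Nw2E; field.
rewrite wE NwE Nw2E w2E expi_N2pi3 expi_2pi3 expi_Npi3 expi_pi3 expi_5pi6.
have r0 := trace0_order hr hdet; have r1 := trace1_order hr hdet.
have rN1 := traceN1_order hr hdet.
have s2 := trace2_scalar hr hdet; have sN2 := traceN2_scalar hr hdet.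
have r2 : \tr g = zeta6 R *+ 2 -> r = 6%N.
  move=> /s2 g2; apply: (order6 hr hdet).
  by rewrite g2 -scalemx1 exprZn zeta6_cube expr1n scaleN1r.
have rN2 : \tr g = - (zeta6 R *+ 2) -> r = 3%N.
  move=> /sN2 g2; apply: (order3 hr hdet).
  by rewrite g2 -scalemx1 exprZn expr1n exprNn zeta6_cube -signr_odd mulN1r
     opprK scale1r.
have trg := eisenstein_trace hr hdet gO.
split; [split|split; split].
- exact: trg.
- move: trg; rewrite !inE.
  by case/or4P=> [/eqP/r0|/eqP/r1|/eqP/rN1|/orP[/eqP/r2|/eqP/rN2]] ->.
- rewrite has_eigenvaluesE ?addNr; first by split.
  by rewrite hdet mulNr -expr2 expi_Npi6_sqr opprB zeta6_sqr.
- split=> [/r0//|r12]; move: trg r1 rN1 r2 rN2; rewrite r12 !inE.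
  case/or4P=> [/eqP //|/eqP-> /(_ erefl)//|/eqP-> _ /(_ erefl)//|].
  by case/orP=> /eqP-> _ _; [move=> /(_ erefl)|move=> _ /(_ erefl)].
- rewrite has_eigenvaluesE; first by rewrite zeta6_sqr subrK; split.
  by rewrite mulr1.
- exact: r1.
- by split=> [/sN2//|->]; rewrite mxtrace_scalar mulNrn.
- exact: rN2.
- rewrite has_eigenvaluesE; first by rewrite addrAC subrr sub0r; split.
  by rewrite hdet zeta6_sqr mulrN1 opprB.
- exact: rN1.
- by split=> [/s2//|->]; rewrite mxtrace_scalar.
- exact: r2.
Qed.
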